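(* Let $\overrightarrow{G}$ be an oriented graph with order $n=3k+t>3$, where $k$ is a positive integer and $t\in\{0,1,2\}$. If $|E(\overrightarrow{G})|=|E(T(n,3))|+1$, then there are at least $f(k)$ copies of $\overrightarrow{TT}_3$ in $\overrightarrow{G}$, where $f(k)=2k$ if $t\in\{0,1\}$ and $f(k)=2k+1$ if $t=2$.
   Context: An oriented graph is a (finite) digraph without loops, without parallel arcs and without directed cycles of length two. Its order is its number of vertices, and $E(\overrightarrow{G})$ is its set of arcs. $T(n,3)$ is the Turán graph: the complete $3$-partite (undirected) graph on $n$ vertices whose partition sets differ in size by at most one; $E(T(n,3))$ is its edge set. $\overrightarrow{TT}_3$ is the transitive tournament on three vertices, i.e. the oriented graph with vertices $u_1,u_2,u_3$ and arcs $u_iu_j$ (from $u_i$ to $u_j$) for $1\le i<j\le 3$. A copy of $\overrightarrow{TT}_3$ in $\overrightarrow{G}$ is a subdigraph of $\overrightarrow{G}$ isomorphic to $\overrightarrow{TT}_3$. *)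

(* Defs.v *)
From mathcomp Require Import all_boot.

Set Implicit Arguments.
Unset Strict Implicit.
Unset Printing Implicit Defensive.

(* A digraph on V is a relation [e : rel V], [e u v] meaning that there is an
   arc from u to v; parallel arcs are thus excluded by the encoding. *)
Definition oriented (V : finType) (e : rel V) : Prop :=
  irreflexive e /\ (forall u v : V, ~~ (e u v && e v u)).

Definition arcs (V : finType) (e : rel V) : {set V * V} :=
  [set p : V * V | e p.1 p.2].

(* The pair (W, F) stands for the digraph with vertex set W and arc set F. *)
Definition subdigraph (V : finType) (e : rel V)
    (H : {set V} * {set V * V}) : bool :=
  (H.2 \subset arcs e) && (H.2 \subset setX H.1 H.1).

Definition isomorphic_to (U V : finType) (h : rel U)
    (H : {set V} * {set V * V}) : bool :=
  [exists f : {ffun U -> V},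
    [&& injectiveb f,
        f @: [set: U] == H.1
      & [forall i : U, forall j : U, ((f i, f j) \in H.2) == h i j]]].

Definition copies (U V : finType) (h : rel U) (e : rel V) :
    {set {set V} * {set V * V}} :=
  [set H | subdigraph e H && isomorphic_to h H].

Definition TT3 : rel 'I_3 := fun i j => i < j.

(* The parts of the Turan graph T(n, r) on {0, ..., n - 1} are the residue
   classes modulo r, which are balanced by [turan_part_balanced] below. *)
Definition turan (n r : nat) : rel 'I_n := fun i j => i %% r != j %% r.

Definition turan_edges (n r : nat) : {set {set 'I_n}} :=
  [set [set p.1; p.2] | p in [set p : 'I_n * 'I_n | turan r p.1 p.2]].

Definition turan_part (n r a : nat) : {set 'I_n} := [set i : 'I_n | i %% r == a].

Lemma turan_part_card (n r a : nat) : a < r ->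
  #|turan_part n r a| = n %/ r + (a < n %% r).
Proof.
move=> ar; have r0 : 0 < r by apply: leq_ltn_trans ar.
have -> : #|turan_part n r a| = \sum_(i < n) (i %% r == a).
  by rewrite -sum1_card big_mkcond /=; apply: eq_bigr => i _; rewrite inE; case: eqP.
elim: n => [|n IHn]; first by rewrite big_ord0 div0n mod0n.
rewrite big_ord_recr /= IHn; have := ltn_pmod n r0.
have -> : n.+1 %/ r = n %/ r + (n %% r).+1 %/ r.
  by rewrite {1}(divn_eq n r) -addnS divnMDl.
have -> : n.+1 %% r = (n %% r).+1 %% r.
  by rewrite {1}(divn_eq n r) -addnS modnMDl.
move: (n %% r) => m; rewrite leq_eqVlt => /orP[/eqP e|lt].
  rewrite e divnn r0 modnn ltn0 addn0 -addnA; congr (_ + _).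
  by move: ar; rewrite -e ltnS; case: (ltngtP a m).
rewrite (divn_small lt) (modn_small lt) addn0 -addnA; congr (_ + _).
by rewrite ltnS; case: (ltngtP a m).
Qed.

Lemma turan_part_balanced (n r a b : nat) : a < r -> b < r ->
  #|turan_part n r a| <= #|turan_part n r b| + 1.
Proof.
move=> ar br; rewrite !turan_part_card // -addnA leq_add2l.
by case: (a < _); rewrite ?leq0n // addn1.
Qed.

(* Main.v *)
(* Let t(n) = |E(T(n,3))| = n ^ 2 / 3 and f(n) = 2n / 3 (rounded down), so that
   t(n) - t(n-1) = f(n).  By induction on n, t(n) + 1 arcs force f(n)
   transitive triangles.  In a tournament on four vertices every vertex lies on
   a transitive triangle, and some arc lies on two of them; so, deleting such
   an arc, t(n) + 2 arcs force f(n) + 2 transitive triangles.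
   For n other than 4 the degree sum yields a vertex v of degree at most f(n),
   which we delete.  This settles the case of degree less than f(n), the case
   n = 1 mod 3, and the case where v lies on a transitive triangle.
   Otherwise the vertices of degree f(n) lie on no transitive triangle, so every
   4-clique consists of vertices of larger degree.  If n = 3q this contradicts
   the degree sum.  If n = 3q + 2, at most q + 2 vertices have larger degree,
   which yields three pairwise adjacent vertices of degree f(n); deleting them
   leaves t(n-3) + 2 arcs, hence f(n-3) + 2 = f(n) transitive triangles. *)
Require Import Defs.
From mathcomp Require Import all_boot zify.

Set Implicit Arguments.
Unset Strict Implicit.
Unset Printing Implicit Defensive.

(** * Degrees, arc counts and arc deletion inside a vertex subset *)

Definition adj (V : finType) (e : rel V) : rel V := fun u v => e u v || e v u.

(** Counting inside a subset [S] of a fixed type turns vertex deletion into [S :\ v], so inductions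
    never change the type. *)
Definition arcs_in (V : finType) (e : rel V) (S : {set V}) : nat :=
  \sum_(u in S) \sum_(v in S) e u v.

Definition nbh (V : finType) (e : rel V) (S : {set V}) (v : V) : {set V} :=
  [set w in S | adj e v w].

Definition clique (V : finType) (e : rel V) (K : {set V}) : Prop :=
  {in K &, forall x y, x != y -> adj e x y}.

(** A transitive triangle has one ordering from source to sink, so these triples count each triangle
    once. *)
Definition tt3_in (V : finType) (e : rel V) (S : {set V}) : {set V * V * V} :=
  [set p | [&& p.1.1 \in S, p.1.2 \in S, p.2 \in S,
               e p.1.1 p.1.2, e p.1.2 p.2 & e p.1.1 p.2]].

Definition on_tt3 (V : finType) (e : rel V) (S : {set V}) (v : V) : bool :=
  [exists p in tt3_in e S, v \in [:: p.1.1; p.1.2; p.2]].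

Definition del_arc (V : finType) (e : rel V) (u v : V) : rel V :=
  fun x y => e x y && ((x, y) != (u, v)).

Lemma mem_tt3 (V : finType) (e : rel V) (S : {set V}) (x y z : V) :
  ((x, y, z) \in tt3_in e S) =
  [&& x \in S, y \in S, z \in S, e x y, e y z & e x z].
Proof. by rewrite inE. Qed.

Lemma adjC (V : finType) (e : rel V) (u v : V) : adj e u v = adj e v u.
Proof. by rewrite /adj orbC. Qed.

Lemma adj_irrefl (V : finType) (e : rel V) (v : V) :
  oriented e -> adj e v v = false.
Proof. by case=> irr _; rewrite /adj irr. Qed.

Lemma nbh_sumE (V : finType) (e : rel V) (S : {set V}) (v : V) : oriented e ->
  #|nbh e S v| = \sum_(w in S) e v w + \sum_(w in S) e w v.
Proof.
case=> _ asym; rewrite -big_split /= -sum1_card.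
rewrite (eq_bigl (fun w => (w \in S) && adj e v w)); last by move=> w; rewrite inE.
rewrite big_mkcondr /=; apply: eq_bigr => w _; rewrite /adj.
by move: (asym v w); case: (e v w); case: (e w v).
Qed.

Lemma sum_nbh (V : finType) (e : rel V) (S : {set V}) : oriented e ->
  \sum_(v in S) #|nbh e S v| = 2 * arcs_in e S.
Proof.
move=> oe; rewrite (eq_bigr _ (fun v _ => nbh_sumE S v oe)) big_split /=.
by rewrite [X in _ + X]exchange_big /= mul2n -addnn.
Qed.

Lemma arcs_inD1 (V : finType) (e : rel V) (S : {set V}) (v : V) :
  oriented e -> v \in S ->
  arcs_in e S = arcs_in e (S :\ v) + #|nbh e S v|.
Proof.
move=> oe vS; rewrite nbh_sumE // /arcs_in (big_setD1 v vS) /=.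
rewrite [X in _ = _ + (_ + X)](big_setD1 v vS) /= (proj1 oe) add0n.
rewrite addnCA; congr (_ + _); rewrite -big_split /=.
by apply: eq_bigr => w _; rewrite (big_setD1 v vS) /= addnC.
Qed.

Lemma nbhD1 (V : finType) (e : rel V) (S : {set V}) (u v : V) :
  u \in S -> adj e v u -> #|nbh e S v| = #|nbh e (S :\ u) v| + 1.
Proof.
move=> uS vu; rewrite (cardsD1 u) inE uS vu addnC; congr (_ + _).
by apply: eq_card => w; rewrite !inE andbA.
Qed.

Lemma nbh_lt (V : finType) (e : rel V) (S : {set V}) (v : V) :
  oriented e -> v \in S -> #|nbh e S v| < #|S|.
Proof.
move=> oe vS; rewrite (cardsD1 v S) vS ltnS; apply: subset_leq_card.
apply/subsetP => w; rewrite !inE => /andP[-> vw]; rewrite andbT.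
by apply: contraTneq vw => ->; rewrite adj_irrefl.
Qed.

Lemma oriented_del (V : finType) (e : rel V) (u v : V) :
  oriented e -> oriented (del_arc e u v).
Proof.
case=> irr asym; split=> [x|x y]; first by rewrite /del_arc irr.
apply: contra (asym x y); rewrite /del_arc.
by move=> /andP[/andP[-> _] /andP[-> _]].
Qed.

Lemma arcs_in_del (V : finType) (e : rel V) (S : {set V}) (u v : V) :
  u \in S -> v \in S -> e u v ->
  arcs_in e S = arcs_in (del_arc e u v) S + 1.
Proof.
(* Writing 1 as a double sum of indicators reduces the identity to one between summands. *)
move=> uS vS uv; have -> : 1 = \sum_(x in S) \sum_(y in S) ((x, y) == (u, v)).
  rewrite (big_setD1 u uS) (big_setD1 v vS) /= eqxx !big1 // => x.
    by rewrite !inE => /andP[/negPf xu _]; apply: big1 => y _; rewrite xpair_eqE xu.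
  by rewrite !inE xpair_eqE => /andP[/negPf-> _]; rewrite andbF.
rewrite /arcs_in -big_split; apply: eq_bigr => x _.
rewrite -big_split; apply: eq_bigr => y _ /=; rewrite /del_arc.
by case: eqP => [[-> ->]|_]; rewrite ?uv //= andbT addn0.
Qed.

Lemma arcs_in_mem (V : finType) (e : rel V) (S : {set V}) :
  0 < arcs_in e S -> exists u v, [/\ u \in S, v \in S & e u v].
Proof.
case: (boolP [exists u in S, exists v in S, e u v]) => [|no].
  by case/exists_inP=> u uS /exists_inP[v vS uv] _; exists u, v.
rewrite /arcs_in big1 // => u uS; apply: big1 => v vS.
case uv: (e u v) => //; case/negP: no.
by apply/exists_inP; exists u => //; apply/exists_inP; exists v.
Qed.

(** Surplus arcs are deleted one by one. An exact count is what bounds the degree sum from above in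
    [low_degree]. *)
Lemma exact_arcs (V : finType) (e : rel V) (S : {set V}) (c : nat) :
  oriented e -> c <= arcs_in e S ->
  exists e' : rel V, [/\ oriented e', subrel e' e & arcs_in e' S = c].
Proof.
move=> + /subnK; move: (_ - c) => d; elim: d e => [|d IHd] e oe E.
  by exists e; split.
have [|u [v [uS vS uv]]] := @arcs_in_mem _ e S; first by rewrite -E.
have [|e' [oe' sub E']] := IHd _ (oriented_del u v oe).
  by move: E; rewrite (arcs_in_del uS vS uv); lia.
by exists e'; split=> // x y /sub /andP[].
Qed.

(** * Transitive triangles and four-cliques *)

Lemma adj_sub (V : finType) (e e' : rel V) : subrel e' e -> subrel (adj e') (adj e).
Proof. by move=> sub x y /orP[] /sub; rewrite /adj => ->; rewrite ?orbT. Qed.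

Lemma tt3_in_sub (V : finType) (e e' : rel V) (S S' : {set V}) :
  subrel e' e -> S' \subset S -> tt3_in e' S' \subset tt3_in e S.
Proof.
move=> sub /subsetP sS; apply/subsetP => p; rewrite !inE.
by case/and5P=> /sS-> /sS-> /sS-> /sub-> /andP[/sub-> /sub->].
Qed.

Lemma on_tt3_sub (V : finType) (e : rel V) (S S' : {set V}) (v : V) :
  S' \subset S -> on_tt3 e S' v -> on_tt3 e S v.
Proof.
move=> sS /exists_inP[p pS' vp]; apply/exists_inP; exists p => //.
by apply: subsetP pS'; apply: tt3_in_sub.
Qed.

Lemma on_tt3_D1 (V : finType) (e : rel V) (S : {set V}) (v : V) :
  on_tt3 e S v -> #|tt3_in e (S :\ v)| < #|tt3_in e S|.
Proof.
case/exists_inP=> p pS vp; apply: proper_card; apply/properP; split.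
  exact/tt3_in_sub/subD1set.
exists p => //; rewrite !inE; move: vp; rewrite !inE.
by case/or3P=> /eqP <-; rewrite eqxx /= ?andbF.
Qed.

(** Among three other vertices of the clique, two are joined to [v] in the same direction; the arc
    between them completes a transitive triangle. *)
Lemma on_tt3_clique (V : finType) (e : rel V) (K : {set V}) (v : V) :
  clique e K -> 4 <= #|K| -> v \in K -> on_tt3 e K v.
Proof.
move=> cK; rewrite (cardsD1 v) => + vK; rewrite vK ltnS => /card_geqP[s []].
case: s => [|b [|c [|d [|? ?]]]] //= U _ sub.
have [/sub bK /sub cK' /sub dK] : [/\ b \in [:: b; c; d], c \in [:: b; c; d]
  & d \in [:: b; c; d]] by rewrite !inE !eqxx ?orbT.
move: U bK cK' dK; rewrite !inE !negb_or andbT.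
move=> /andP[/andP[bc bd] cd] /andP[bv bK] /andP[cv cK'] /andP[dv dK].
have out x y : x \in K -> y \in K -> x != y -> e v x -> e v y -> on_tt3 e K v.
  move=> xK yK xy vx vy; case/orP: (cK x y xK yK xy) => A; apply/exists_inP.
    by exists (v, x, y); rewrite ?mem_tt3 ?inE ?eqxx ?vK ?xK ?yK ?vx ?vy ?A.
  by exists (v, y, x); rewrite ?mem_tt3 ?inE ?eqxx ?vK ?xK ?yK ?vx ?vy ?A.
have inn x y : x \in K -> y \in K -> x != y -> e x v -> e y v -> on_tt3 e K v.
  move=> xK yK xy vx vy; case/orP: (cK x y xK yK xy) => A; apply/exists_inP.
    by exists (x, y, v); rewrite ?mem_tt3 ?inE ?eqxx ?orbT ?vK ?xK ?yK ?vx ?vy ?A.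
  by exists (y, x, v); rewrite ?mem_tt3 ?inE ?eqxx ?orbT ?vK ?xK ?yK ?vx ?vy ?A.
case/orP: (cK b v bK vK bv) => B; case/orP: (cK c v cK' vK cv) => C.
- exact: inn bc B C.
- by case/orP: (cK d v dK vK dv) => D; [apply: inn bd B D | apply: out cd C D].
- by case/orP: (cK d v dK vK dv) => D; [apply: inn cd C D | apply: out bd B D].
exact: out bc B C.
Qed.

(* Both triangles contain the arc [uv], so deleting it destroys them. *)
Lemma tt3_del2 (V : finType) (e : rel V) (S : {set V}) (u v : V)
    (p q : V * V * V) :
  p != q -> p \in tt3_in e S -> q \in tt3_in e S ->
  (u, v) \in [:: (p.1.1, p.1.2); (p.1.2, p.2); (p.1.1, p.2)] ->
  (u, v) \in [:: (q.1.1, q.1.2); (q.1.2, q.2); (q.1.1, q.2)] ->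
  #|tt3_in (del_arc e u v) S| + 2 <= #|tt3_in e S|.
Proof.
move=> pq pS qS up uq.
have notin r : (u, v) \in [:: (r.1.1, r.1.2); (r.1.2, r.2); (r.1.1, r.2)] ->
    r \notin tt3_in (del_arc e u v) S.
  move=> ur; apply/negP; rewrite inE /del_arc => /and5P[_ _ _].
  move=> /andP[_ A] /andP[/andP[_ B] /andP[_ C]].
  by move: ur; rewrite !inE -!(eq_sym _ (u, v)) (negPf A) (negPf B) (negPf C).
have := subset_leq_card (_ : tt3_in (del_arc e u v) S :|: [set p; q]
  \subset tt3_in e S).
rewrite cardsU cards2 pq (_ : _ :&: _ = set0) ?cards0 ?subn0; last first.
  apply/setP=> r; rewrite !inE; apply/negP=> /andP[rT /orP[]/eqP rE].
    by case/negP: (notin _ up); rewrite inE -rE.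
  by case/negP: (notin _ uq); rewrite inE -rE.
apply; rewrite !subUset !sub1set pS qS !andbT.
by apply: tt3_in_sub => // x y /andP[].
Qed.

(* The fourth vertex is joined in the same direction to two vertices of a
   transitive triangle, hence lies on a second one sharing an arc with it. *)
Lemma clique_del_arc (V : finType) (e : rel V) (S K : {set V}) : oriented e ->
  K \subset S -> clique e K -> 4 <= #|K| ->
  exists u v, [/\ u \in S, v \in S, e u v &
    #|tt3_in (del_arc e u v) S| + 2 <= #|tt3_in e S|].
Proof.
move=> [irr asym] /subsetP sKS cK K4.
have /card_gt0P[a aK] : 0 < #|K| by lia.
have /exists_inP[[[x y] z] + _] := on_tt3_clique cK K4 aK.
rewrite mem_tt3 => /and5P[xK yK zK xy /andP[yz xz]].
have /card_gt0P[d] : 0 < #|K :\: [set x; y; z]|.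
  have := cardsD K [set x; y; z]; have := subset_leq_card (subsetIr K [set x; y; z]).
  have : #|[set x; y; z]| <= 3.
    by rewrite setUC cardsU1 cards2; case: (_ \notin _); case: (_ != _).
  lia.
rewrite !inE !negb_or => /andP[/andP[/andP[dx dy] dz] dK].
have [xS yS zS dS] := And4 (sKS _ xK) (sKS _ yK) (sKS _ zK) (sKS _ dK).
have tS : (x, y, z) \in tt3_in e S by rewrite mem_tt3 xS yS zS xy yz xz.
have done2 u v q : u \in S -> v \in S -> e u v -> (x, y, z) != q ->
    q \in tt3_in e S ->
    (u, v) \in [:: (x, y); (y, z); (x, z)] ->
    (u, v) \in [:: (q.1.1, q.1.2); (q.1.2, q.2); (q.1.1, q.2)] ->
    exists u v, [/\ u \in S, v \in S, e u v &
    #|tt3_in (del_arc e u v) S| + 2 <= #|tt3_in e S|].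
  move=> uS vS uv pq qS up uq; exists u, v; split=> //.
  exact: tt3_del2 pq tS qS up uq.
case/orP: (cK d x dK xK dx) => A; case/orP: (cK d y dK yK dy) => B.
- by apply: (done2 x y (d, x, y)); rewrite ?mem_tt3 ?inE ?eqxx ?orbT ?xpair_eqE
    ?(eq_sym x d) ?(negPf dx) ?xS ?yS ?dS ?xy ?xz ?yz ?A ?B.
- case/orP: (cK d z dK zK dz) => C.
    by apply: (done2 x z (d, x, z)); rewrite ?mem_tt3 ?inE ?eqxx ?orbT ?xpair_eqE
      ?(eq_sym x d) ?(negPf dx) ?xS ?zS ?dS ?xy ?xz ?yz ?A ?C.
  by apply: (done2 y z (y, z, d)); rewrite ?mem_tt3 ?inE ?eqxx ?orbT ?xpair_eqE
    ?(eq_sym z d) ?(negPf dz) ?andbF ?yS ?zS ?dS ?xy ?xz ?yz ?yz ?B ?C.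
- case/orP: (cK d z dK zK dz) => C.
    by apply: (done2 y z (d, y, z)); rewrite ?mem_tt3 ?inE ?eqxx ?orbT ?xpair_eqE
      ?(eq_sym x d) ?(negPf dx) ?yS ?zS ?dS ?xy ?xz ?yz ?yz ?B ?C.
  by apply: (done2 x z (x, z, d)); rewrite ?mem_tt3 ?inE ?eqxx ?orbT ?xpair_eqE
    ?(eq_sym z d) ?(negPf dz) ?andbF ?xS ?zS ?dS ?xy ?xz ?yz ?xz ?A ?C.
by apply: (done2 x y (x, y, d)); rewrite ?mem_tt3 ?inE ?eqxx ?orbT ?xpair_eqE
  ?(eq_sym z d) ?(negPf dz) ?andbF ?xS ?yS ?dS ?xy ?xz ?yz ?A ?B.
Qed.

(** * Arithmetic of the Turán number *)

(* [n ^ 2 %/ 3] is the number of edges of T(n, 3), and [2 * n %/ 3], which is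
   the bound f(k) of the theorem, is its minimum degree. *)
Lemma turan3_step (n r : nat) : r <= 2 ->
  2 * (3 * n + r) %/ 3 = 2 * n + (r == 2) /\
  (3 * n + r) ^ 2 %/ 3 = 3 * n ^ 2 + 2 * n * r + (r == 2).
Proof.
move=> r2; have d x y z : z < 3 -> x = y * 3 + z -> x %/ 3 = y.
  by move=> z3 ->; rewrite divnMDl // divn_small ?addn0.
split.
- by case: r r2 => [|[|[|]]] //= _; [apply: (d _ _ 0)|apply: (d _ _ 2)|apply: (d _ _ 1)]; lia.
by case: r r2 => [|[|[|]]] //= _; [apply: (d _ _ 0)|apply: (d _ _ 1)|apply: (d _ _ 1)]; nia.
Qed.

Lemma mod3P (n : nat) : exists q r, r <= 2 /\ n = 3 * q + r.
Proof. by exists (n %/ 3), (n %% 3); lia. Qed.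

Lemma turan3_succ (n : nat) :
  n.+1 ^ 2 %/ 3 = n ^ 2 %/ 3 + 2 * n.+1 %/ 3.
Proof.
have [q [r [r2 ->]]] := mod3P n; have [_ ->] := turan3_step q r2.
case: r r2 => [|[|[|]]] //= _.
- have -> : (3 * q + 0).+1 = 3 * q + 1 by lia.
  by have [-> ->] := @turan3_step q 1 isT; nia.
- have -> : (3 * q + 1).+1 = 3 * q + 2 by lia.
  by have [-> ->] := @turan3_step q 2 isT; nia.
have -> : (3 * q + 2).+1 = 3 * q.+1 + 0 by lia.
by have [-> ->] := @turan3_step q.+1 0 isT; nia.
Qed.

(** * Four-cliques above the Turán number *)

(** Let n be the order of [S]. If all degrees exceed [2 * n %/ 3], the degree sum
    [2 * (n ^ 2 %/ 3 + 1)] and the bound n - 1 on degrees leave only n = 4, where all degrees are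
    3. *)
Lemma low_degree (V : finType) (e : rel V) (S : {set V}) : oriented e ->
  arcs_in e S = #|S| ^ 2 %/ 3 + 1 ->
  (exists2 v, v \in S & #|nbh e S v| <= 2 * #|S| %/ 3) \/
  clique e S /\ #|S| = 4.
Proof.
move=> oe E; case: (boolP [exists v in S, #|nbh e S v| <= 2 * #|S| %/ 3]).
  by case/exists_inP=> v vS le; left; exists v.
rewrite negb_exists_in => /forall_inP high; right.
have {}high v : v \in S -> 2 * #|S| %/ 3 < #|nbh e S v|.
  by move/high; rewrite -ltnNge.
have /card_gt0P[v0 v0S] : 0 < #|S|.
  rewrite lt0n; apply: contra_eq_neq E => /eqP; rewrite cards_eq0 => /eqP->.
  by rewrite /arcs_in big_set0 addn1.
have S4 : #|S| = 4.
  have := leq_ltn_trans (high _ v0S) (nbh_lt oe v0S).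
  have : \sum_(v in S) (2 * #|S| %/ 3).+1 <= \sum_(v in S) #|nbh e S v|.
    exact: leq_sum.
  rewrite sum_nbh // sum_nat_const E.
  have [q [r [r2 ->]]] := mod3P #|S|; have [-> ->] := turan3_step q r2.
  by move: r2; case: r => [|[|[|]]] //= _; nia.
split=> // x y xS yS xy.
have : y \in nbh e S x; last by rewrite inE => /andP[].
have : nbh e S x \subset S :\ x.
  apply/subsetP => w; rewrite !inE => /andP[-> xw]; rewrite andbT.
  by apply: contraTneq xw => ->; rewrite adj_irrefl.
move=> sub; have /eqP -> : nbh e S x == S :\ x; last by rewrite !inE eq_sym xy.
rewrite eqEcard sub /=; have := high x xS; have := cardsD1 x S.
by rewrite xS S4 /= -[2 * 4 %/ 3]/2; lia.
Qed.

Lemma clique_sub (V : finType) (e e' : rel V) (K : {set V}) :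
  subrel e' e -> clique e' K -> clique e K.
Proof. by move=> sub cK x y xK yK xy; apply/(adj_sub sub)/cK. Qed.

(** By [turan3_succ], deleting the low-degree vertex keeps the arc count above the Turán number; the
    descent can only end at a clique of order four. *)
Lemma turan3_clique (V : finType) (e : rel V) (S : {set V}) : oriented e ->
  #|S| ^ 2 %/ 3 < arcs_in e S ->
  exists K : {set V}, [/\ K \subset S, clique e K & 4 <= #|K|].
Proof.
move: {2}#|S| (leqnn #|S|) => n; elim: n e S => [|n IHn] e S leS oe.
  move: leS; rewrite leqn0 cards_eq0 => /eqP ->.
  by rewrite /arcs_in big_set0.
rewrite -addn1 => /(exact_arcs oe)[e' [oe' sub E]].
case: (low_degree oe' E) => [[v vS low]|[cS S4]]; last first.
  by exists S; split; rewrite ?S4 //; apply: clique_sub cS.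
have vS' := cardsD1 v S; rewrite vS in vS'.
have [||K [KS cK K4]] := IHn e' (S :\ v) _ oe'.
- by lia.
- by move: E low; rewrite (arcs_inD1 oe' vS) vS' turan3_succ; lia.
exists K; split; last by [].
  by apply: subset_trans KS (subD1set _ _).
exact: clique_sub cK.
Qed.

(** * Vertices of minimum degree and the induction *)

Lemma clique_common_nbh (V : finType) (e : rel V) (S K : {set V}) (u : V) :
  clique e K -> clique e (u |: K :&: nbh e S u).
Proof.
move=> cK x y; rewrite !inE => /orP[/eqP->|/and3P[xK _ ux]].
  by case/orP=> [/eqP->|/and3P[_ _ uy] //]; rewrite eqxx.
case/orP=> [/eqP->|/and3P[yK _ _]] xy; first by rewrite adjC.
exact: cK.
Qed.

(** Each vertex of degree above [d] adds at least one to the minimal degree sum. *)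
Lemma high_degree_card (V : finType) (e : rel V) (S : {set V}) (d : nat) :
  oriented e -> (forall v, v \in S -> d <= #|nbh e S v|) ->
  #|[set v in S | d < #|nbh e S v|]| + #|S| * d <= 2 * arcs_in e S.
Proof.
move=> oe low; rewrite -sum_nbh // -sum1dep_card big_mkcondr /= -sum_nat_const.
rewrite -big_split; apply: leq_sum => v vS /=.
by case: ltnP => // _; apply: low.
Qed.

(** Deleting an arc of a 4-clique that lies on two triangles leaves enough arcs for the assumed
    bound. It is stated for a fixed [S] so that the induction hypothesis can be plugged in. *)
Lemma turan3_tt3_del (V : finType) (S : {set V}) (c : nat) :
  (forall e : rel V, oriented e -> #|S| ^ 2 %/ 3 < arcs_in e S ->
     c <= #|tt3_in e S|) ->
  forall e : rel V, oriented e -> #|S| ^ 2 %/ 3 + 1 < arcs_in e S ->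
  c + 2 <= #|tt3_in e S|.
Proof.
move=> Q e oe E; have [|K [KS cK K4]] := @turan3_clique _ e S oe; first by lia.
have [u [v [uS vS uv]]] := clique_del_arc oe KS cK K4.
apply: leq_trans; rewrite leq_add2r; apply: Q; first exact: oriented_del.
by move: E; rewrite (arcs_in_del uS vS uv); lia.
Qed.

(* [H], the set of vertices of large degree, has at most [q + 2] elements and
   contains [K].  As [K] has at most two vertices in N(u), N(u) is not inside
   [H]; as it has at most one in the common neighbourhood of [u] and [v],
   neither is the latter. *)
Lemma low_triangle (V : finType) (e : rel V) (S K : {set V}) (q : nat) (u : V) :
  oriented e -> #|S| = 3 * q + 2 -> arcs_in e S = #|S| ^ 2 %/ 3 + 1 ->
  (forall v, v \in S -> 2 * q + 1 <= #|nbh e S v|) ->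
  (forall v, v \in S -> #|nbh e S v| = 2 * q + 1 -> ~~ on_tt3 e S v) ->
  K \subset S -> clique e K -> 4 <= #|K| ->
  u \in S -> #|nbh e S u| = 2 * q + 1 ->
  exists v w, [/\ v \in S, w \in S,
    #|nbh e S v| = 2 * q + 1, #|nbh e S w| = 2 * q + 1
    & [/\ adj e u v, adj e u w & adj e v w]].
Proof.
move=> oe S3 E low no KS cK K4 uS du.
have := high_degree_card oe low; set H := [set _ in _ | _]; rewrite E S3.
have [_ ->] := turan3_step q (leqnn 2); rewrite /= => Hq.
(* The degree sum 6q^2 + 8q + 4 exceeds (3q + 2)(2q + 1) by q + 2. *)
have {}Hq : #|H| <= q + 2 by nia.
have noK (K' : {set V}) v : K' \subset S -> clique e K' -> v \in K' ->
    #|nbh e S v| = 2 * q + 1 -> #|K'| < 4.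
  move=> K'S cK' vK' dv; rewrite ltnNge; apply/negP => K'4.
  case/negP: (no v (subsetP K'S _ vK') dv).
  exact: on_tt3_sub K'S (on_tt3_clique cK' K'4 vK').
have HP v : v \in S -> v \notin H -> #|nbh e S v| = 2 * q + 1.
  by move=> vS; rewrite inE vS -leqNgt /= => ?; apply/eqP; rewrite eqn_leq low // andbT.
have KH : K \subset H.
  apply/subsetP => x xK; apply: contraLR K4 => xH; rewrite -ltnNge.
  have xS := subsetP KS x xK; exact: noK KS cK xK (HP _ xS xH).
(* Inclusion-exclusion for [K] and [A] inside [H]. *)
have meet (A : {set V}) : A \subset H -> #|A| + 4 <= q + 2 + #|K :&: A|.
  move=> AH; have := cardsUI K A.
  have := subset_leq_card (_ : K :|: A \subset H); rewrite subUset KH AH => /(_ isT).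
  lia.
have uN v : v \in nbh e S v = false by rewrite inE adj_irrefl ?andbF.
have Ku : #|K :&: nbh e S u| <= 2.
  have K'S : u |: K :&: nbh e S u \subset S.
    by rewrite subUset sub1set uS (subset_trans (subsetIl _ _)).
  have := noK _ u K'S (@clique_common_nbh _ _ S _ u cK) (setU11 _ _) du.
  by rewrite cardsU1 inE uN andbF.
have /subsetPn[v vu vH] : ~~ (nbh e S u \subset H) by apply/negP => /meet; lia.
have [vS uv] : v \in S /\ adj e u v by apply/andP; move: vu; rewrite inE.
have dv := HP v vS vH.
(* Together with [u] and [v] these vertices form a clique through [v], which has at most three
   elements by [noK]. *)
have Kuv : #|K :&: (nbh e S u :&: nbh e S v)| <= 1.
  set K' := v |: (u |: K :&: nbh e S u) :&: nbh e S v.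
  have K'S : K' \subset S.
    by rewrite subUset sub1set vS; apply/subsetP => x; rewrite !inE => /andP[_ /andP[]].
  have cK' : clique e K' by do 2!apply: clique_common_nbh.
  have := noK _ v K'S cK' (setU11 _ _) dv.
  rewrite /K' setIUl (_ : [set u] :&: _ = [set u]); last first.
    by apply/setIidPl; rewrite sub1set inE uS adjC.
  rewrite -setIA !cardsU1 !inE !adj_irrefl // !(andbF, andFb) /=.
  by have -> : v == u = false by apply/eqP => vE; rewrite vE adj_irrefl in uv.
(* The common neighbourhood has at least 2(2q + 1) - (3q + 2) = q elements, while [meet] would allow
   at most q - 1. *)
have /subsetPn[w] : ~~ (nbh e S u :&: nbh e S v \subset H).
  apply/negP => /meet; have := cardsUI (nbh e S u) (nbh e S v).
  have := subset_leq_card (_ : nbh e S u :|: nbh e S v \subset S).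
  rewrite subUset; have -> : nbh e S u \subset S by apply/subsetP=> x; rewrite inE => /andP[].
  have -> : nbh e S v \subset S by apply/subsetP=> x; rewrite inE => /andP[].
  by move=> /(_ isT); lia.
move=> + wH; rewrite !inE => /andP[/andP[wS uw] /andP[_ vw]].
by exists v, w; split; rewrite ?(HP w).
Qed.

Lemma turan3_tt3 (V : finType) (e : rel V) (S : {set V}) : oriented e ->
  #|S| ^ 2 %/ 3 < arcs_in e S -> 2 * #|S| %/ 3 <= #|tt3_in e S|.
Proof.
move: {2}#|S| (leqnn #|S|) => n; elim: n e S => [|n IHn] e0 S leS oe0.
  by move: leS; rewrite leqn0 => /eqP->.
rewrite -addn1 => /(exact_arcs oe0)[e [oe sub E]].
apply: leq_trans (subset_leq_card (tt3_in_sub sub (subxx S))).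
have [|K [KS cK K4]] := @turan3_clique _ e S oe; first by rewrite E addn1.
case: (low_degree oe E) => [[v vS dv]|[_ S4]]; last first.
  have [x [y [_ _ _]]] := clique_del_arc oe KS cK K4.
  by apply: leq_trans; rewrite S4 leq_addl.
have Q1 (S' : {set V}) : #|S'| < #|S| -> forall e', oriented e' ->
    #|S'| ^ 2 %/ 3 < arcs_in e' S' -> 2 * #|S'| %/ 3 <= #|tt3_in e' S'|.
  by move=> lt e' oe' E'; apply: IHn => //; rewrite -ltnS (leq_trans lt).
have Q2 S' lt := turan3_tt3_del (Q1 S' lt).
have cardS' x : x \in S -> #|S| = #|S :\ x|.+1.
  by move=> xS; rewrite (cardsD1 x S) xS.
have arcS' x : x \in S ->
    arcs_in e (S :\ x) + #|nbh e S x| = #|S :\ x| ^ 2 %/ 3 + 2 * #|S| %/ 3 + 1.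
  by move=> xS; rewrite -arcs_inD1 // E (cardS' x xS) turan3_succ.
have subT (S' : {set V}) : S' \subset S -> #|tt3_in e S'| <= #|tt3_in e S|.
  by move=> sS; apply/subset_leq_card/tt3_in_sub.
have [q [r [r2 Sq]]] := mod3P #|S|.
have [f3 t3] := turan3_step q r2; rewrite -Sq in f3 t3.
(* Here t(n-1) + 2 arcs remain, so [Q2] gives f(n-1) + 2 triangles, at least f(n). *)
case: (boolP [exists x in S, #|nbh e S x| < 2 * #|S| %/ 3]).
  case/exists_inP => x xS dx; apply: leq_trans (subT _ (subD1set S x)).
  have cS := cardS' x xS; have := Q2 (S :\ x) _ e oe.
  by have := arcS' x xS; rewrite -cS; lia.
rewrite negb_exists_in => /forall_inP low.
have {}low x : x \in S -> 2 * #|S| %/ 3 <= #|nbh e S x|.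
  by move/low; rewrite -leqNgt.
have {}dv : #|nbh e S v| = 2 * #|S| %/ 3 by apply/eqP; rewrite eqn_leq dv low.
have minT x : x \in S -> #|nbh e S x| = 2 * #|S| %/ 3 ->
    2 * #|S :\ x| %/ 3 <= #|tt3_in e (S :\ x)|.
  move=> xS dx; have cS := cardS' x xS; apply: Q1 => //; first by lia.
  by have := arcS' x xS; lia.
case: (boolP [exists x in S, (#|nbh e S x| == 2 * #|S| %/ 3) && on_tt3 e S x]).
  case/exists_inP => x xS /andP[/eqP dx tx].
  have cS := cardS' x xS; have := minT x xS dx; have := on_tt3_D1 tx; lia.
rewrite negb_exists_in => /forall_inP no.
have {}no x : x \in S -> #|nbh e S x| = 2 * #|S| %/ 3 -> ~~ on_tt3 e S x.
  by move=> /no + dx; rewrite dx eqxx.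
case: r r2 Sq f3 t3 => [|[|[|]]] //= _ Sq f3 t3.
(* For n = 3q the degree sum 6q^2 + 2 allows at most two vertices of degree above 2q, but [K] has
   four. *)
- have := high_degree_card oe low; set H := [set _ in _ | _] => Hc.
  have KH : K \subset H.
    apply/subsetP => x xK; have xS := subsetP KS x xK; rewrite inE xS /=.
    rewrite ltn_neqAle low // andbT; apply/negP => /eqP /esym/(no x xS)/negP.
    by apply; apply: on_tt3_sub KS (on_tt3_clique cK K4 xK).
  by have := subset_leq_card KH; move: Hc; rewrite E; nia.
(* For n = 3q + 1, f(n) = f(n-1) = 2q. *)
- have := minT v vS dv; have := subT _ (subD1set S v); have := cardS' v vS.
  by move: #|S| Sq f3 #|S :\ v| #|tt3_in e (S :\ v)| #|tt3_in e S|; lia.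
rewrite f3 in low no dv.
have [x [w [xS wS dx dw [vx vw xw]]]] := low_triangle oe Sq E low no KS cK K4 vS dv.
have ne a b : adj e a b -> b != a.
  by move=> ab; apply: contraTneq ab => ->; rewrite adj_irrefl.
pose S1 := S :\ v; pose S2 := S1 :\ x; pose S3 := S2 :\ w.
have xS1 : x \in S1 by rewrite !inE xS ne.
have wS2 : w \in S2 by rewrite !inE wS !ne.
have := nbhD1 vS (_ : adj e x v); rewrite adjC => /(_ vx) d1.
have := nbhD1 vS (_ : adj e w v); rewrite adjC => /(_ vw) d2.
have := nbhD1 xS1 (_ : adj e w x); rewrite adjC => /(_ xw) d3.
have := arcs_inD1 oe vS; have := arcs_inD1 oe xS1; have := arcs_inD1 oe wS2.
have := cardS' v vS; have := cardsD1 x S1; have := cardsD1 w S2.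
rewrite wS2 xS1 -/S1 -/S2 -/S3 => c3 c2 c1 a3 a2 a1.
have sub3 : S3 \subset S by apply/subsetP => y; rewrite !inE => /and4P[].
apply: leq_trans (subT _ sub3).
have [p qE] : exists p, q = p.+1.
  by exists q.-1; move: c1 c2 c3 Sq; clear; lia.
have cS3 : #|S3| = 3 * p + 2 by move: c1 c2 c3 Sq; rewrite qE; clear; lia.
have [f3' t3'] := turan3_step p (leqnn 2).
have q2 : q ^ 2 = p ^ 2 + 2 * p + 1 by rewrite qE; clear; nia.
(* The three deleted vertices meet 3(2q + 1) - 3 = 6q arcs, while t(n) - t(n-3) = 6q + 1.
   Generalizing the cardinals and the square leaves a linear goal. *)
have E3 : #|S3| ^ 2 %/ 3 + 1 < arcs_in e S3.
  rewrite cS3 t3' /=; move: E dv dx dw d1 d2 d3 a1 a2 a3; rewrite t3 -/S1 -/S2 q2 qE.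
  move: (p ^ 2) #|nbh e S v| #|nbh e S x| #|nbh e S1 x| #|nbh e S w| #|nbh e S1 w|.
  move: #|nbh e S2 w| (arcs_in e S) (arcs_in e S1) (arcs_in e S2) (arcs_in e S3).
  by clear; lia.
rewrite f3 qE; apply: leq_trans (Q2 S3 _ e oe E3).
  by rewrite cS3 f3'; clear; lia.
by rewrite Sq cS3 qE; clear; lia.
Qed.

(** * Turán edges, copies and the theorem *)

(** Edges are counted at their larger end j, which has [j %/ 3] smaller vertices in its own class.
    Its share [j - j %/ 3] is the increment in [turan3_succ]. *)
Lemma turan3_edges_ge (n : nat) : n ^ 2 %/ 3 <= #|turan_edges n 3|.
Proof.
pose P := [set p : 'I_n * 'I_n | (p.1 < p.2) && turan 3 p.1 p.2].
have PE : #|P| = \sum_(j < n) \sum_(i < j) (i %% 3 != j %% 3).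
  rewrite -sum1dep_card big_mkcondr /= (eq_bigr (fun p : 'I_n * 'I_n =>
    (fun i j : 'I_n => nat_of_bool (turan 3 i j)) p.1 p.2)); last first.
    by move=> p _; case: turan.
  rewrite -(pair_big_dep xpredT (fun i j : 'I_n => i < j)
    (fun i j : 'I_n => nat_of_bool (turan 3 i j))) /=.
  rewrite (exchange_big_dep xpredT) //=; apply: eq_bigr => j _.
  by rewrite (big_ord_widen n (fun i => nat_of_bool (i %% 3 != j %% 3))) // ltnW.
have row j : \sum_(i < j) (i %% 3 != j %% 3) + j %/ 3 = j.
  have := turan_part_card j (ltn_pmod j (isT : 0 < 3)).
  rewrite ltnn addn0 => <-; rewrite -sum1dep_card [X in _ + X]big_mkcond -big_split /=.
  rewrite -[RHS]card_ord -sum1_card; apply: eq_bigr => i _.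
  by case: (_ == _).
have PT : #|P| = n ^ 2 %/ 3.
  have -> : #|P| = \sum_(j < n) (j - j %/ 3).
    by rewrite PE; apply: eq_bigr => j _; apply: (canRL (addnK _)).
  elim: n {P PE} => [|n IHn]; first by rewrite big_ord0.
  by rewrite big_ord_recr /= IHn turan3_succ; congr (_ + _); clear; lia.
have inj : {in P &, injective (fun p : 'I_n * 'I_n => [set p.1; p.2])}.
  move=> [a b] [c d]; rewrite !inE /= => /andP[ab _] /andP[cd _] /setP E.
  have := E a; have := E b; rewrite !inE !eqxx orbT /=.
  move=> /esym/orP[]/eqP ? /esym/orP[]/eqP ?; subst=> //.
  - by rewrite ltnn in ab.
  - by move: ab cd; lia.
  - by rewrite ltnn in ab.
rewrite -PT -(card_in_imset inj); apply: subset_leq_card.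
by apply: imsetS; apply/subsetP => p; rewrite !inE => /andP[].
Qed.

(** The arc set of a transitive triangle determines its order from source to sink, so distinct
    triples give distinct copies. *)
Lemma tt3_in_copies (V : finType) (e : rel V) : oriented e ->
  #|tt3_in e setT| <= #|copies TT3 e|.
Proof.
move=> [irr asym].
have asymF x y : e x y -> e y x -> False.
  by move=> xy yx; move: (asym x y); rewrite xy yx.
have neq x y : e x y -> x != y.
  by move=> xy; apply: contraTneq xy => ->; rewrite irr.
pose phi (p : V * V * V) : {set V} * {set V * V} :=
  ([set p.1.1; p.1.2; p.2], [set (p.1.1, p.1.2); (p.1.2, p.2); (p.1.1, p.2)]).
have inj : {in tt3_in e setT &, injective phi}.
  move=> [[x y] z] [[x' y'] z']; rewrite !mem_tt3 !in_setT /=.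
  move=> /and3P[xy yz xz] /and3P[xy' yz' xz'] [_ /setP E].
  have := E (x, y); have := E (y, z); have := E (x, z).
  rewrite !inE !eqxx ?orbT !xpair_eqE /=.
  (* Any matching of the three arcs other than the identity forces a loop or two opposite arcs. *)
  move=> /esym/orP[/orP[]|]/andP[/eqP ? /eqP ?]
    /esym/orP[/orP[]|]/andP[/eqP ? /eqP ?]
    /esym/orP[/orP[]|]/andP[/eqP ? /eqP ?]; subst=> //;
  by exfalso; eauto using asymF; match goal with
    | H : is_true (e ?a ?a) |- _ => rewrite irr in H end.
rewrite -(card_in_imset inj); apply: subset_leq_card.
apply/subsetP => _ /imsetP[[[x y] z] + ->]; rewrite mem_tt3 !in_setT /=.
move=> /and3P[xy yz xz]; rewrite inE; apply/andP; split.
  rewrite /subdigraph /= !subUset !sub1set !inE /= xy yz xz !eqxx.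
  by rewrite ?orbT.
have [nxy nyz nxz] := And3 (neq _ _ xy) (neq _ _ yz) (neq _ _ xz).
pose f := [ffun i : 'I_3 => nth x [:: x; y; z] i].
have fE i : f i = nth x [:: x; y; z] i by rewrite ffunE.
apply/existsP; exists f; apply/and3P; split.
- apply/injectiveP => i j; rewrite !fE => /eqP.
  rewrite nth_uniq //= ?ltn_ord // => [/eqP/val_inj //|].
  by rewrite !inE negb_or nxy nyz nxz.
- apply/eqP/setP => w; rewrite !inE; apply/imsetP/idP.
    move=> [[[|[|[|i]]] //= lt] _ ->]; rewrite fE /= eqxx ?orbT //.
  move=> /orP[/orP[]|] /eqP ->.
  + by exists (inord 0); rewrite ?fE ?inordK.
  + by exists (inord 1); rewrite ?fE ?inordK.
  by exists (inord 2); rewrite ?fE ?inordK.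
apply/forallP => i; apply/forallP => j; rewrite !fE !inE !xpair_eqE /TT3.
case: i => [[|[|[|i]]] //= _]; case: j => [[|[|[|j]]] //= _];
  rewrite ?eqxx ?(eq_sym y x) ?(eq_sym z x) ?(eq_sym z y)
    ?(negPf nxy) ?(negPf nyz) ?(negPf nxz) ?andbF ?orbT //.
Qed.

Theorem theorem1p8 (V : finType) (e : rel V) (n k t : nat)
  (hG : oriented e)
  (hV : #|V| = n)
  (hn : n = 3 * k + t)
  (hn3 : 3 < n)
  (hk : 0 < k)
  (ht : t \in [:: 0; 1; 2])
  (hE : #|arcs e| = #|turan_edges n 3| + 1) :
  (if t == 2 then 2 * k + 1 else 2 * k) <= #|copies TT3 e|.
Proof.
apply: leq_trans (tt3_in_copies hG).
have t2 : t <= 2 by move: ht; rewrite !inE => /or3P[] /eqP ->.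
have arcsE : arcs_in e setT = #|arcs e|.
  rewrite -sum1dep_card big_mkcond /= /arcs_in pair_big /=.
  by apply: eq_big => [p|p _]; rewrite ?inE //; case: (e _ _).
have := @turan3_tt3 _ e setT hG.
rewrite arcsE hE cardsT hV addn1 ltnS turan3_edges_ge => /(_ isT).
apply: leq_trans; have [+ _] := turan3_step k t2; rewrite -hn => ->.
by case: eqP; rewrite ?addn0.
Qed.
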